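(* Let $G$ be a connected $(P_5,K_4)$-free graph. Then $cop(G)\leq 2$.
   Context: All graphs are finite, simple and undirected. $P_n$ and $K_n$ denote the path and complete graph on $n$ vertices. A graph is $(H_1,\dots,H_k)$-free if it contains no induced subgraph isomorphic to any $H_i$. Game of cops and robber on a connected graph: first all cops are placed on vertices (several may share a vertex), then the robber chooses a vertex; afterwards cops and robber move alternately, starting with the cops, a move consisting of staying put or moving to an adjacent vertex. The cops win if after finitely many rounds some cop is on the same vertex as the robber. The cop number $cop(G)$ is the minimum number of cops that guarantees a win in each connected component of $G$. *)

(* Defs.v *)
From HB Require Import structures.
From mathcomp Require Import all_boot.
From mathcomp Require Import boolp.

Set Implicit Arguments.
Unset Strict Implicit.
Unset Printing Implicit Defensive.

Record sgraph := SGraph {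
  vertex :> finType;
  adj : rel vertex;
  adj_sym : symmetric adj;
  adj_irrefl : irreflexive adj }.

Definition path_rel n : rel 'I_n := fun i j => (i.+1 == j) || (j.+1 == i).

Lemma path_rel_sym n : symmetric (@path_rel n).
Proof. by move=> i j; rewrite /path_rel orbC. Qed.

Lemma path_rel_irrefl n : irreflexive (@path_rel n).
Proof. by move=> i; rewrite /path_rel orbb eqn_leq ltnn. Qed.

Definition path_graph n : sgraph :=
  SGraph (@path_rel_sym n) (@path_rel_irrefl n).

Definition complete_rel n : rel 'I_n := fun i j => i != j.

Lemma complete_rel_sym n : symmetric (@complete_rel n).
Proof. by move=> i j; rewrite /complete_rel eq_sym. Qed.

Lemma complete_rel_irrefl n : irreflexive (@complete_rel n).
Proof. by move=> i; rewrite /complete_rel eqxx. Qed.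

Definition complete_graph n : sgraph :=
  SGraph (@complete_rel_sym n) (@complete_rel_irrefl n).

(* [f] is an isomorphism from [H] onto the subgraph of [G] induced by the
   image of [f]. *)
Definition has_induced (H G : sgraph) : Prop :=
  exists f : H -> G,
    injective f /\ forall x y : H, adj (f x) (f y) = adj x y.

Definition free_of (H G : sgraph) : Prop := ~ has_induced H G.

Definition same_component (G : sgraph) (x y : G) : bool :=
  connect (@adj G) x y.

(* The graph with no vertex counts as connected; its cop number is 0. *)
Definition connected_graph (G : sgraph) : Prop :=
  forall x y : G, same_component x y.

Definition legal_move (G : sgraph) (x y : G) : bool := (x == y) || adj x y.

(* [s h] is the position of the cops once the robber has occupied
   successively the vertices listed in [h] and the cops have answered; thus
   [s [::]] is their initial placement. *)
Definition cop_strategy (G : sgraph) (k : nat) := seq G -> 'I_k -> G.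

Definition robber_play (G : sgraph) (v : G) (r : nat -> G) : Prop :=
  same_component v (r 0) /\ forall n, legal_move (r n) (r n.+1).

(* Against the play [r], the cops stand at [s (mkseq r n)] when the robber
   arrives on [r n], and then move to [s (mkseq r n.+1)]; a capture may occur
   at either of these two moments. *)
Definition winning_strategy (G : sgraph) (v : G) k (s : cop_strategy G k) :
    Prop :=
  (forall i, same_component v (s [::] i)) /\
  forall r : nat -> G, robber_play v r ->
    (forall n i, legal_move (s (mkseq r n) i) (s (mkseq r n.+1) i)) /\
    (exists n i, s (mkseq r n) i = r n \/ s (mkseq r n.+1) i = r n).

Definition cops_win (G : sgraph) (k : nat) : Prop :=
  forall v : G, exists s : cop_strategy G k, winning_strategy v s.

Lemma cops_win_card (G : sgraph) : cops_win G #|G|.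
Proof.
move=> v; pose p (i : 'I_#|G|) : G :=
  if same_component v (enum_val i) then enum_val i else v.
exists (fun _ => p); split=> [i|r [vr0 _]].
  by rewrite /p; case: ifP => // _; apply: connect0.
split=> [n i|]; first by rewrite /legal_move eqxx.
by exists 0, (enum_rank (r 0)); left; rewrite /p enum_rankK vr0.
Qed.

Lemma cops_win_exists (G : sgraph) : exists k, `[< cops_win G k >].
Proof. by exists #|G|; apply/asboolP/cops_win_card. Qed.

Definition cop_number (G : sgraph) : nat := ex_minn (cops_win_exists G).

(* Main.v *)
Require Import Defs.
From HB Require Import structures.
From mathcomp Require Import all_boot.

(** Suppose that the robber can evade two cops forever.  A connected triple
    [a - b - c] with the largest neighbourhood is dominating, for otherwise
    swapping its vertices for vertices met on the way to an undominated one would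
    enlarge the neighbourhood.  Put the cops on [a] and [b]; from now on each
    attack forces the robber onto some vertex, whose adjacencies to the finitely
    many vertices named so far are strongly restricted by domination and by the
    absence of induced [P_5] and [K_4].  Every vertex reached is named and kept,
    and so is every position [(p, q, r)] known to be safe for the robber, because
    a later attack may start again from any of them.  A tree of at most nineteen
    attacks leaves the robber without any answer; the two trees (for
    [a, b, c] inducing [K_3] or [P_3]) are given explicitly and the enumeration
    of the possible answers is done by computation. *)

Set Implicit Arguments.
Unset Strict Implicit.
Unset Printing Implicit Defensive.

(** * Trees with lists of subtrees *)

Section RoseTree.

Variable L : Type.

Inductive tree := Node of L & seq tree.

(** The generated principle gives no induction hypothesis on subtrees nested in a list, whence this
    one. *)
Lemma tree_nested_ind (P : tree -> Prop) :
  (forall l Ts, foldr (fun T => and (P T)) True Ts -> P (Node l Ts)) ->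
  forall T, P T.
Proof.
move=> IH; fix loop 1 => -[l Ts]; apply: IH.
by elim: Ts => [//|T Ts IHTs]; split; [apply: loop|].
Qed.

Lemma all2_mem (S : eqType) (P : tree -> Prop) (r : tree -> S -> bool) Ts s y :
  foldr (fun T => and (P T)) True Ts -> all2 r Ts s -> y \in s ->
  exists2 T, P T & r T y.
Proof.
elim: Ts s => [|T Ts IH] [|z s] //= [PT PTs] /andP[rTz rs].
rewrite inE => /predU1P[->|]; first by exists T.
exact: IH.
Qed.

End RoseTree.

(** * Adjacency codes and the two kinds of certificates *)

Section Codes.

(* The graph on [0, ..., n - 1] in which [j < i] are adjacent when the [j]-th
   entry of the [i]-th row is [true]; appending a row adds a vertex. *)
Definition code := seq bitseq.

Implicit Types (H : code) (t : bitseq).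

Definition code_adj H i j :=
  (j < i) && nth false (nth [::] H i) j || (i < j) && nth false (nth [::] H j) i.

Definition code_legal H i j := (i == j) || code_adj H i j.

Definition code_edges H : seq (nat * nat) :=
  [seq e <- [seq (i, j) | i <- iota 0 (size H), j <- iota 0 (size H)]
     | code_adj H e.1 e.2].

(* Pairs [(s, s')] such that a new vertex adjacent to all of [s] and to none of
   [s'] creates a [P_5], as its first, second or third vertex, or a [K_4]. *)
Definition forbidden H : seq (seq nat * seq nat) :=
  let a := code_adj H in
  let I := iota 0 (size H) in
  let E := code_edges H in
  let EE := [seq (e, f) | e <- E, f <- E] in
  let EI := [seq (e, i) | e <- E, i <- I] in
  let EII := [seq (e, i) | e <- EI, i <- I] in
  [seq ([:: w.1.1], [:: w.1.2; w.2.1; w.2.2])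
     | w <- EE & [&& a w.1.2 w.2.1, ~~ a w.1.1 w.2.1, ~~ a w.1.1 w.2.2
                   & ~~ a w.1.2 w.2.2]]
  ++ [seq ([:: w.2; w.1.1.1], [:: w.1.1.2; w.1.2])
       | w <- EII & [&& a w.1.1.2 w.1.2, ~~ a w.1.1.1 w.1.2, ~~ a w.2 w.1.1.1,
                       ~~ a w.2 w.1.1.2 & ~~ a w.2 w.1.2]]
  ++ [seq ([:: w.1.2; w.2.1], [:: w.1.1; w.2.2])
       | w <- EE & [&& ~~ a w.1.1 w.2.1, ~~ a w.1.1 w.2.2, ~~ a w.1.2 w.2.1
                     & ~~ a w.1.2 w.2.2]]
  ++ [seq ([:: w.1.1; w.1.2; w.2], [::])
       | w <- EI & a w.1.1 w.2 && a w.1.2 w.2].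

Definition matches t (f : seq nat * seq nat) :=
  all (nth false t) f.1 && ~~ has (nth false t) f.2.

Fixpoint bitseqs n : seq bitseq :=
  if n is n'.+1 then
    map (cons true) (bitseqs n') ++ map (cons false) (bitseqs n')
  else [:: [::]].

Lemma mem_bitseqs t : t \in bitseqs (size t).
Proof.
elim: t => //= b t IH; rewrite mem_cat.
by case: b; rewrite (map_f (cons _) IH) ?orbT.
Qed.

Definition types H (P : pred bitseq) : seq bitseq :=
  let F := forbidden H in
  [seq t <- [seq t <- bitseqs (size H) | P t] | ~~ has (matches t) F].

Definition hits t i j k := [|| nth false t i, nth false t j | nth false t k].

Definition swap_tree := tree (nat * nat * nat).
Definition Swap i j k Ts : swap_tree := Node (i, j, k) Ts.

(* At a node [Swap i j k], the triple [i - j - k] dominates a vertex that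
   [0, 1, 2] does not; hence, if [0, 1, 2] dominates the most vertices, it
   dominates a vertex that [i, j, k] does not, on whose row we branch. *)
Fixpoint improvable (T : swap_tree) H : bool :=
  let: Node (i, j, k) Ts := T in
  let n := size H in
  [&& [&& i < n, j < n & k < n], code_adj H i j, code_adj H j k,
      has (fun h => ~~ [|| code_adj H h 0, code_adj H h 1 | code_adj H h 2]
                    && [|| code_adj H h i, code_adj H h j | code_adj H h k])
          (iota 0 n)
    & all2 improvable Ts
        [seq rcons H t
           | t <- types H (fun t => hits t 0 1 2 && ~~ hits t i j k)]].

Definition move_tree := tree (nat * nat * nat * (nat * nat)).
Definition Move p q r p' q' Ts : move_tree := Node (p, q, r, (p', q')) Ts.

(* [S] lists the positions (cop, cop, robber) that are safe for the robber.  At a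
   node [Move p q r p' q'], the cops move from [p, q] to [p', q'] while the
   robber is on [r]; we branch on his answer, which is either one of the
   vertices of [H] or a new vertex. *)
Fixpoint cops_catch (T : move_tree) H (S : seq (nat * nat * nat)) : bool :=
  let: Node (p, q, r, (p', q')) Ts := T in
  let n := size H in
  [&& (p, q, r) \in S, p' < n, q' < n, code_legal H p p', code_legal H q q'
    & all2 (fun T st => cops_catch T st.1 st.2) Ts
        ([seq (H, (p', q', i) :: S)
            | i <- iota 0 n & [&& code_legal H r i, ~~ code_legal H p' i
                                & ~~ code_legal H q' i]]
         ++ [seq (rcons H t, (p', q', n) :: S)
              | t <- types H (fun t => [&& nth false t r, ~~ nth false t p',
                                       ~~ nth false t q' & hits t 0 1 2])])].

Definition K3_code : code := [:: [::]; [:: true]; [:: true; true]].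
Definition P3_code : code := [:: [::]; [:: true]; [:: false; true]].

(** Start of the swap argument: vertex 3 is undominated, and vertex 4 is a dominated neighbour of
    3. *)
Definition undominated_codes H : seq code :=
  let H' := rcons H (nseq 3 false) in
  [seq rcons H' t
     | t <- types H' (fun t => nth false t 3 && hits t 0 1 2)].

(** One tree per possible row of vertex 4, in order of enumeration. A node without children is a
    swap whose loss no admissible vertex can witness. *)
Definition swaps_K3 : seq swap_tree :=
  [:: Swap 0 1 4 [:: Swap 0 2 5 [::]];
      Swap 0 2 4 [:: Swap 0 1 5 [::]];
      Swap 0 4 3 [::];
      Swap 0 1 4 [:: Swap 1 2 4 [::]];
      Swap 0 1 4 [::];
      Swap 0 2 4 [::]].

Definition swaps_P3 : seq swap_tree :=
  [:: Swap 0 1 4 [:: Swap 1 2 4 [::]];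
      Swap 0 1 4 [::];
      Swap 0 4 2 [:: Swap 0 1 5 [::]];
      Swap 1 2 4 [::];
      Swap 0 1 4 [::]].

(** Vertex 3 is the robber's first position, and further numbers follow the order of discovery. A
    node without children leaves him no answer. *)
Definition moves_K3 : move_tree :=
  Move 0 1 3 1 2 [::
    Move 0 1 3 4 0 [::
      Move 1 2 4 0 5 [::
        Move 1 2 4 1 6 [::
          Move 1 6 7 2 6 [:: Move 2 6 7 3 4 [::]];
          Move 1 6 7 5 3 [::]];
        Move 0 5 6 0 1 [:: Move 0 1 7 1 6 [::]]];
      Move 1 2 4 2 3 [::
        Move 4 0 5 4 6 [::
          Move 0 1 3 0 7 [:: Move 0 7 8 6 5 [::]];
          Move 1 2 4 0 2 [:: Move 0 2 8 4 0 [::]]];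
        Move 4 0 5 3 2 [::
          Move 4 0 5 0 2 [::
            Move 0 2 5 1 2 [:: Move 1 2 8 5 1 [::]]]]]]].

Definition moves_P3 : move_tree :=
  Move 0 1 3 0 2 [::
    Move 0 2 4 1 2 [::
      Move 0 1 3 1 4 [::
        Move 0 2 4 1 6 [::
          Move 1 6 7 1 2 [::];
          Move 1 6 7 1 0 [::];
          Move 1 6 7 1 0 [:: Move 1 0 8 0 7 [::]]];
        Move 1 2 5 4 1 [::
          Move 0 2 4 7 2 [::
            Move 7 2 4 2 3 [:: Move 2 3 8 3 4 [::]]]]]]].

Lemma swaps_K3_ok : all2 improvable swaps_K3 (undominated_codes K3_code).
Proof. by vm_compute. Qed.

Lemma swaps_P3_ok : all2 improvable swaps_P3 (undominated_codes P3_code).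
Proof. by vm_compute. Qed.

(** With cops on 0 and 1, a safe robber is adjacent to neither, hence, by domination, to 2. *)
Definition first_code H := rcons H [:: false; false; true].

Lemma moves_K3_ok : cops_catch moves_K3 (first_code K3_code) [:: (0, 1, 3)].
Proof. by vm_compute. Qed.

Lemma moves_P3_ok : cops_catch moves_P3 (first_code P3_code) [:: (0, 1, 3)].
Proof. by vm_compute. Qed.

End Codes.

(** * Codes realized in a graph *)

Section Realization.

Variables (G : sgraph) (x0 : G).
Hypothesis G_P5_free : free_of (path_graph 5) G.
Hypothesis G_K4_free : free_of (complete_graph 4) G.

Implicit Types (H : code) (vs : seq G).

Lemma no_P5 (a b c d e : G) :
  adj a b -> adj b c -> adj c d -> adj d e ->
  ~~ adj a c -> ~~ adj a d -> ~~ adj a e -> ~~ adj b d -> ~~ adj b e ->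
  ~~ adj c e -> False.
Proof.
move=> ab bc cd de /negbTE ac /negbTE ad /negbTE ae /negbTE bd /negbTE be.
move=> /negbTE ce; pose f (i : 'I_5) := nth a [:: a; b; c; d; e] i.
have fE i j : adj (f i) (f j) = path_rel i j.
  case: i j => [[|[|[|[|[|i]]]]] // ?] [[|[|[|[|[|j]]]]] // ?];
  by rewrite /f /path_rel /= ?adj_irrefl // 1?adj_sym.
apply: G_P5_free; exists f; split=> // i j fij.
(* Injectivity: distinct vertices of [P_5] have distinct neighbourhoods. *)
have rel k : path_rel i k = path_rel j k by rewrite -!fE fij.
move: (rel (@Ordinal 5 0 isT)) (rel (@Ordinal 5 1 isT)).
move: (rel (@Ordinal 5 2 isT)) (rel (@Ordinal 5 3 isT)).
move: (rel (@Ordinal 5 4 isT)).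
case: i j {fij rel} => [[|[|[|[|[|i]]]]] // ?] [[|[|[|[|[|j]]]]] // ?];
  rewrite /path_rel //= => *; exact: val_inj.
Qed.

Lemma no_K4 (a b c d : G) :
  adj a b -> adj a c -> adj a d -> adj b c -> adj b d -> adj c d -> False.
Proof.
move=> ab ac ad bc bd cd; pose f (i : 'I_4) := nth a [:: a; b; c; d] i.
have fE i j : adj (f i) (f j) = complete_rel i j.
  case: i j => [[|[|[|[|i]]]] // ?] [[|[|[|[|j]]]] // ?];
  by rewrite /f /complete_rel -val_eqE /= ?adj_irrefl // 1?adj_sym.
apply: G_K4_free; exists f; split=> // i j fij.
by apply/eqP/negPn; move: (fE i j); rewrite fij adj_irrefl /complete_rel => <-.
Qed.

Definition row_of vs (x : G) := [seq adj x v | v <- vs].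

(** Only adjacencies are recorded; [vs] may repeat vertices, so any vertex can be appended. *)
Definition realizes H vs :=
  size vs = size H /\
  forall i j, i < size H -> j < size H ->
    adj (nth x0 vs i) (nth x0 vs j) = code_adj H i j.

Lemma nth_row_of H vs x i :
  realizes H vs -> i < size H ->
  nth false (row_of vs x) i = adj x (nth x0 vs i).
Proof. by case=> sz _ i_lt; rewrite (nth_map x0) ?sz. Qed.

Lemma realizes_rcons H vs x :
  realizes H vs -> realizes (rcons H (row_of vs x)) (rcons vs x).
Proof.
move=> Hvs; have [sz Hadj] := Hvs.
split=> [|i j]; first by rewrite !size_rcons sz.
rewrite size_rcons !ltnS /code_adj !nth_rcons sz.
case: (ltngtP i) => // [i_lt|->] _; case: (ltngtP j) => // [j_lt|->] _.
- by rewrite Hadj.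
- by rewrite (nth_row_of x Hvs) // adj_sym; case: ltngtP i_lt.
- by rewrite orbF (nth_row_of x Hvs).
- by rewrite adj_irrefl.
Qed.

Lemma code_edgesP H e :
  e \in code_edges H -> [/\ code_adj H e.1 e.2, e.1 < size H & e.2 < size H].
Proof.
rewrite mem_filter => /andP[-> /allpairsP[[i j] /= [iI jI ->]]] /=.
by move: iI jI; rewrite !mem_iota.
Qed.

Lemma forbidden_unmatched H vs x f :
  realizes H vs -> f \in forbidden H -> ~~ matches (row_of vs x) f.
Proof.
move=> Hvs; have [_ Hadj] := Hvs; have rowE := nth_row_of x Hvs.
have I_lt i : i \in iota 0 (size H) -> i < size H by rewrite mem_iota.
pose v i := nth x0 vs i.
rewrite /forbidden !mem_cat => /or4P[] /mapP[w]; rewrite mem_filter.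
- case/andP=> /and4P[bc ac ad bd] /allpairsP[[[a b] [c d]] /= []].
  case/code_edgesP=> /= ab la lb /code_edgesP[/= cd lc ld] Ew ->.
  move: bc ac ad bd ab cd; rewrite {w}Ew -!Hadj // /matches /= !rowE //.
  rewrite andbT orbF !negb_or => bc ac ad bd ab cd; apply/negP=> /and4P[*].
  exact: (@no_P5 x (v a) (v b) (v c) (v d)).
- case/andP=> /and5P[cd bd ab ac ad] /allpairsP[[[[b c] d] a] /= []].
  case/allpairsP=> [[[b' c'] d'] /= [/code_edgesP[/= bc lb lc] /I_lt ld Ew']].
  case: Ew' bc lb lc ld => <- <- <- bc lb lc ld /I_lt la Ew ->.
  move: cd bd ab ac ad bc; rewrite {w}Ew -!Hadj // /matches /= !rowE //.
  rewrite andbT orbF negb_or => cd bd ab ac ad bc; apply/negP=> /and3P[].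
  case/andP=> xa xb xc xd; apply: (@no_P5 (v a) x (v b) (v c) (v d)) => //.
  by rewrite adj_sym.
- case/andP=> /and4P[ac ad bc bd] /allpairsP[[[a b] [c d]] /= []].
  case/code_edgesP=> /= ab la lb /code_edgesP[/= cd lc ld] Ew ->.
  move: ac ad bc bd ab cd; rewrite {w}Ew -!Hadj // /matches /= !rowE //.
  rewrite andbT orbF negb_or => ac ad bc bd ab cd; apply/negP=> /and3P[].
  case/andP=> xb xc xa xd; apply: (@no_P5 (v a) (v b) x (v c) (v d)) => //;
    by rewrite adj_sym.
- case/andP=> /andP[ac bc] /allpairsP[[[a b] c] /= [/code_edgesP[/= ab la lb]]].
  move=> /I_lt lc Ew ->; move: ac bc ab; rewrite {w}Ew -!Hadj // /matches /=.
  rewrite !rowE // !andbT => ac bc ab; apply/negP=> /and3P[*].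
  exact: (@no_K4 x (v a) (v b) (v c)).
Qed.

Lemma mem_types H vs x (P : pred bitseq) :
  realizes H vs -> P (row_of vs x) -> row_of vs x \in types H P.
Proof.
move=> Hvs Px; rewrite !mem_filter Px /=; apply/andP; split.
  apply/hasPn=> f fF; exact: forbidden_unmatched fF.
by case: Hvs => <- _; rewrite -(size_map (adj x)) mem_bitseqs.
Qed.

End Realization.

(** * Existence of a dominating connected triple *)

Section Domination.

Variable G : sgraph.
Hypothesis G_P5_free : free_of (path_graph 5) G.
Hypothesis G_K4_free : free_of (complete_graph 4) G.

Definition covers (a b c x : G) := [|| adj x a, adj x b | adj x c].

Lemma improvable_not_max (a b c : G) :
  (forall a' b' c' : G, adj a' b' -> adj b' c' ->
     #|covers a' b' c'| <= #|covers a b c|) ->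
  forall T H vs, realizes a H [:: a, b, c & vs] -> ~~ improvable T H.
Proof.
move=> max; elim/tree_nested_ind=> -[[i j] k] Ts IH H vs Hvs.
have [sz Hadj] := Hvs; pose v n := nth a [:: a, b, c & vs] n.
have lt3 n : n < 3 -> n < size H.
  by move=> n_lt; rewrite -sz; apply: leq_trans n_lt _.
apply/negP=> /and5P[/and3P[il jl kl] ij jk /hasP[h]].
rewrite mem_iota /= => hl; rewrite -!Hadj ?(lt3 0, lt3 1, lt3 2) //.
case/andP=> h012 hijk allT.
(* Otherwise the swapped triple would cover all that [a, b, c] cover, and [v h] besides, against
   maximality. *)
have [x xabc xijk] : exists2 x, covers a b c x & ~~ covers (v i) (v j) (v k) x.
  apply/exists_inP; apply: contraT => /exists_inPn sub.
  suff : #|covers a b c| < #|covers (v i) (v j) (v k)|.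
    by rewrite ltnNge max // Hadj.
  apply: proper_card; apply/properP; split.
    by apply/subsetP=> x /sub; rewrite negbK.
  by exists (v h).
have xrow : row_of [:: a, b, c & vs] x
    \in types H (fun t => hits t 0 1 2 && ~~ hits t i j k).
  apply: (mem_types _ _ Hvs) => //.
  rewrite /hits !(nth_row_of x Hvs) ?(lt3 0, lt3 1, lt3 2) //.
  exact/andP.
have [T /(_ _ (rcons vs x)) IHT] := all2_mem IH allT (map_f (rcons H) xrow).
by apply/negP/IHT/realizes_rcons.
Qed.

Lemma connected_triple_realizes (a b c : G) :
  adj a b -> adj b c ->
  realizes a K3_code [:: a; b; c] \/ realizes a P3_code [:: a; b; c].
Proof.
move=> ab bc; have ba : adj b a by rewrite adj_sym.
have cb : adj c b by rewrite adj_sym.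
case ac: (adj a c); [left|right]; move: (ac); rewrite adj_sym => ca;
  split=> // -[|[|[|i]]] // [|[|[|j]]] // _ _;
  by rewrite /= ?adj_irrefl ?(ab, bc, ba, cb, ac, ca).
Qed.

Lemma exists_dominating_triple (x y : G) :
  connected_graph G -> adj x y ->
  exists a b c : G, [/\ adj a b, adj b c & forall z, covers a b c z].
Proof.
move=> conn xy.
pose P (w : G * G * G) := adj w.1.1 w.1.2 && adj w.1.2 w.2.
(* Triples may repeat a vertex, so an edge already provides one. *)
have P0 : P (x, y, x) by rewrite /P /= xy adj_sym.
case: (arg_maxnP (fun w => #|covers w.1.1 w.1.2 w.2|) P0) => -[[a b] c].
rewrite /P /= => /andP[ab bc] max0; exists a, b, c; split=> //.
have max (a' b' c' : G) : adj a' b' -> adj b' c' ->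
    #|covers a' b' c'| <= #|covers a b c|.
  by move=> ab' bc'; apply: (max0 (a', b', c')); rewrite /= ab'.
(* By connectedness it is enough that no edge [w u] leaves the covered set, which contains [a]. *)
suff closed_cov : closed (@adj G) (covers a b c).
  move=> z; have := closed_connect closed_cov (conn a z).
  by rewrite !unfold_in /covers ab orbT => <-.
apply: intro_closed => [|w u wu]; first exact/sym_connect_sym/adj_sym.
rewrite !unfold_in => wcov; apply: contraT => ucov.
have absurd H Ts : realizes a H [:: a; b; c] -> size H = 3 ->
    all2 improvable Ts (undominated_codes H) -> False.
  move=> Habc szH allT; have Hu := realizes_rcons u Habc.
  have urow : row_of [:: a; b; c] u = nseq 3 false.
    by move: ucov; rewrite !negb_or => /and3P[/negbTE ? /negbTE ? /negbTE ?];
      congr [:: _; _; _].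
  rewrite urow in Hu.
  have wrow : row_of [:: a; b; c; u] w \in
      types (rcons H (nseq 3 false)) (fun t => nth false t 3 && hits t 0 1 2).
    by apply: (mem_types _ _ Hu) => //=; rewrite wu.
  (* No induction here: [all2_mem] only serves to pick the tree for the row of [w]. *)
  have trivP : foldr (fun T : swap_tree => and True) True Ts.
    by elim: (Ts) => //= *; split.
  have [T _] := all2_mem trivP allT (map_f (rcons _) wrow).
  apply/negP/(improvable_not_max max); exact: (realizes_rcons w Hu).
case: (connected_triple_realizes ab bc) => /absurd.
  by move=> /(_ swaps_K3 erefl swaps_K3_ok).
by move=> /(_ swaps_P3 erefl swaps_P3_ok).
Qed.

End Domination.

(** * No robber evades two cops forever *)

Section Evasion.

Variable G : sgraph.
Hypothesis G_connected : connected_graph G.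
Hypothesis G_P5_free : free_of (path_graph 5) G.
Hypothesis G_K4_free : free_of (complete_graph 4) G.

Variable safe : G -> G -> G -> Prop.
Hypothesis safe_far : forall p q r, safe p q r ->
  ~~ legal_move p r /\ ~~ legal_move q r.
Hypothesis safe_step : forall p q r p' q', safe p q r ->
  legal_move p p' -> legal_move q q' ->
  exists2 r', legal_move r r' & safe p' q' r'.

Lemma cops_catch_unsafe (a b c : G) :
  (forall x, covers a b c x) ->
  forall T H S vs, realizes a H [:: a, b, c & vs] ->
  (forall p q r, (p, q, r) \in S -> [/\ p < size H, q < size H, r < size H &
     safe (nth a [:: a, b, c & vs] p) (nth a [:: a, b, c & vs] q)
          (nth a [:: a, b, c & vs] r)]) ->
  ~~ cops_catch T H S.
Proof.
move=> dom; elim/tree_nested_ind=> -[[[p q] r] [p' q']] Ts IH H S vs Hvs HS.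
have [sz Hadj] := Hvs; pose v n := nth a [:: a, b, c & vs] n.
have legalE i j : i < size H -> j < size H -> code_legal H i j ->
    legal_move (v i) (v j).
  move=> il jl; rewrite /legal_move Hadj //.
  by case/predU1P=> [->|->]; rewrite ?eqxx ?orbT.
apply/negP=> /and5P[/HS[pl ql rl safe_pqr] pl' ql' pp' /andP[qq' allT]].
have [x rx safe_x] :=
  safe_step safe_pqr (legalE _ _ pl pl' pp') (legalE _ _ ql ql' qq').
have [px qx] := safe_far safe_x.
(* Answer on a named vertex: the code is unchanged, and [px], [qx] show that [i] passes the
   filter. *)
have old i : i < size H -> v i = x -> code_legal H r i -> False.
  move=> il vi ri.
  have mem_i : (H, (p', q', i) :: S) \in [seq (H, (p', q', i) :: S)
      | i <- iota 0 (size H) & [&& code_legal H r i, ~~ code_legal H p' i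
                                & ~~ code_legal H q' i]].
    apply: map_f; rewrite mem_filter mem_iota il ri !andbT /=.
    by apply/andP; split; [move: px|move: qx]; apply: contra => /legalE;
      rewrite vi; apply.
  have [|T IHT] := all2_mem IH allT (y := (H, (p', q', i) :: S)).
    by rewrite mem_cat mem_i.
  apply/negP/(IHT _ _ vs) => // p1 q1 r1; rewrite inE => /predU1P[|/HS//].
  by case=> -> -> ->; split=> //=; rewrite -/(v i) vi.
(* Staying put is an answer on a named vertex, namely [r]. *)
have [rx_eq|rx_adj] := predU1P rx.
  by apply: (old r) => //; rewrite /code_legal eqxx.
have [/(nthP a)[i il vi]|_] := boolP (x \in [:: a, b, c & vs]).
  rewrite sz in il; apply: (old i) => //.
  by rewrite /code_legal -Hadj // [nth a _ i]vi rx_adj orbT.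
move: px qx; rewrite !negb_or => /andP[_ px] /andP[_ qx].
have xrow : row_of [:: a, b, c & vs] x \in types H (fun t =>
    [&& nth false t r, ~~ nth false t p', ~~ nth false t q' & hits t 0 1 2]).
  apply: (mem_types _ _ Hvs) => //.
  rewrite !(nth_row_of x Hvs) // adj_sym rx_adj adj_sym px adj_sym qx /=.
  exact: dom.
have [|T IHT] := all2_mem IH allT
    (y := (rcons H (row_of [:: a, b, c & vs] x), (p', q', size H) :: S)).
  rewrite mem_cat; apply/orP; right.
  exact: (map_f (fun t => (rcons H t, (p', q', size H) :: S)) xrow).
apply/negP/(IHT _ _ (rcons vs x)); first exact: realizes_rcons.
move=> p1 q1 r1; rewrite inE size_rcons -!rcons_cons !nth_rcons sz.
case/predU1P=> [[-> -> ->]|/HS[lp lq lr]].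
  by rewrite pl' ql' ltnn eqxx !ltnS (ltnW pl') (ltnW ql') leqnn.
by rewrite lp lq lr !ltnS (ltnW lp) (ltnW lq) (ltnW lr).
Qed.

Lemma no_evasion (x : G) : ~ (forall p q, exists r, safe p q r).
Proof.
move=> start; have [r /safe_far[xr _]] := start x x.
(* A robber safe from two cops on [x] is elsewhere, so a path to him leaves [x] along an edge. *)
have [y xy] : exists y, adj x y.
  have /connectP[[|y s] /= p_s r_last] := G_connected x r.
    by rewrite r_last /legal_move eqxx in xr.
  by exists y; case/andP: p_s.
have [a [b [c [ab bc dom]]]] :=
  exists_dominating_triple G_P5_free G_K4_free G_connected xy.
have [d safe_abd] := start a b; have [ad bd] := safe_far safe_abd.
move: ad bd; rewrite !negb_or => /andP[_ /negbTE ad] /andP[_ /negbTE bd].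
have d_row : row_of [:: a; b; c] d = [:: false; false; true].
  move: (dom d) ad bd; rewrite /covers ![adj d _]adj_sym /= => + ad bd.
  by rewrite ad bd /= ![adj d _]adj_sym ad bd => ->.
have absurd H T : realizes a H [:: a; b; c] -> size H = 3 ->
    cops_catch T (first_code H) [:: (0, 1, 3)] -> False.
  move=> /(realizes_rcons d); rewrite d_row => Hd szH.
  apply/negP/(@cops_catch_unsafe a b c dom T _ _ [:: d]) => // p q r'.
  by rewrite inE size_rcons szH => /eqP[-> -> ->].
case: (connected_triple_realizes ab bc) => /absurd.
  by move=> /(_ moves_K3 erefl moves_K3_ok).
by move=> /(_ moves_P3 erefl moves_P3_ok).
Qed.

End Evasion.

(** * The finite game and its strategies *)

Section Game.

Variable G : sgraph.
Implicit Types (c : G * G) (r : G).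

Definition on_robber c r := (c.1 == r) || (c.2 == r).

Definition cop_moves c c' := legal_move c.1 c'.1 && legal_move c.2 c'.2.

Fixpoint wins_within n c r : bool :=
  on_robber c r ||
  if n is n'.+1 then
    [exists c', cop_moves c c' && (on_robber c' r ||
      [forall r', legal_move r r' ==> wins_within n' c' r'])]
  else false.

Lemma wins_within_leq m n c r :
  m <= n -> wins_within m c r -> wins_within n c r.
Proof.
elim: m n c r => [|m IH] n c r le_mn.
  by rewrite /= orbF => cr; case: n le_mn => /= [|n] _; rewrite cr.
case: n le_mn => // n le_mn /= /orP[->//|/existsP[c' /andP[cc' win]]].
apply/orP; right; apply/existsP; exists c'; rewrite cc'.
case/orP: win => [->//|/forallP win]; apply/orP; right; apply/forallP=> r'.
by apply/implyP=> rr'; apply: IH le_mn _; apply: (implyP (win r')).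
Qed.

(** The graph is finite and [wins_within] is monotone, so the maximum of the individual bounds
    serves. *)
Lemma wins_within_uniform (P : pred G) c :
  (forall r, P r -> exists n, wins_within n c r) ->
  exists n, forall r, P r -> wins_within n c r.
Proof.
move=> win; have /fin_all_exists[f fP] (r : G) :
    exists n, P r -> wins_within n c r.
  by case Pr: (P r); [have [n] := win r Pr; exists n|exists 0].
exists (\max_r f r) => r /fP; apply: wins_within_leq; exact: leq_bigmax.
Qed.

Definition evades c r := forall n, ~~ wins_within n c r.

Lemma evades_far c r :
  evades c r -> ~~ legal_move c.1 r /\ ~~ legal_move c.2 r.
Proof.
move=> ev; have := ev 1; rewrite /= negb_or negb_exists => /andP[_ /forallP no].
split; apply/negP=> cr.
  by have := no (r, c.2); rewrite /cop_moves /on_robber /= cr /legal_move !eqxx.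
have := no (c.1, r); rewrite /cop_moves /on_robber /= cr /legal_move !eqxx.
by rewrite orbT.
Qed.

(** If every answer lost, a common bound [n] for them would make [c, r] won within [n.+1]. *)
Lemma evades_step c c' r : evades c r -> cop_moves c c' ->
  exists2 r', legal_move r r' & evades c' r'.
Proof.
move=> ev cc'.
have [//|no] := boolp.EM (exists2 r', legal_move r r' & evades c' r').
have [|n win] := @wins_within_uniform (legal_move r) c'.
  move=> r' rr'; have [//|lose] := boolp.EM (exists n, wins_within n c' r').
  by case: no; exists r' => // n; apply/negP=> win; apply: lose; exists n.
case/negP: (ev n.+1) => /=; apply/orP; right; apply/existsP; exists c'.
rewrite cc' /=; apply/orP; right; apply/forallP=> r'; apply/implyP; exact: win.
Qed.

(** The default [c] lets the cops stay put, which keeps the answer legal in lost positions. *)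
Definition answer n c r : G * G :=
  odflt c [pick c' | cop_moves c c' && (on_robber c' r ||
    [forall r', legal_move r r' ==> wins_within n c' r'])].

Lemma cop_moves_answer n c r : cop_moves c (answer n c r).
Proof.
rewrite /answer; case: pickP => [c' /andP[]//|_].
by rewrite /cop_moves /legal_move !eqxx.
Qed.

Lemma answer_wins n c r : wins_within n.+1 c r ->
  [|| on_robber c r, on_robber (answer n c r) r |
     [forall r', legal_move r r' ==> wins_within n (answer n c r) r']].
Proof.
move=> /= /orP[->//|/existsP[c' c'P]]; rewrite /answer.
case: pickP => [c'' /andP[_ ->]|/(_ c')]; first by rewrite orbT.
by rewrite c'P.
Qed.

(* The cops' position after the history [h], when they have [n] moves to win. *)
Fixpoint pursue n c (h : seq G) : G * G :=
  if h is r :: h' then pursue n.-1 (answer n.-1 c r) h' else c.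

Lemma pursue_rcons n c h r :
  pursue n c (rcons h r) = answer (n - size h).-1 (pursue n c h) r.
Proof.
elim: h n c => [|r' h IH] n c /=; first by rewrite subn0.
by rewrite IH -[n.-1]subn1 -subnDA.
Qed.

Lemma cops_win2 n c : connected_graph G ->
  (forall r, wins_within n c r) -> cops_win G 2.
Proof.
move=> conn win v.
pose s (h : seq G) (i : 'I_2) :=
  if i == ord0 then (pursue n c h).1 else (pursue n c h).2.
have s_on h r : on_robber (pursue n c h) r -> exists i, s h i = r.
  by case/orP=> /eqP; [exists ord0|exists ord_max].
exists s; split=> [i|r [_ r_legal]]; first exact: conn.
have mkseqS k : mkseq r k.+1 = rcons (mkseq r k) (r k).
  by rewrite /mkseq -addn1 iotaD map_cat cats1.
split=> [k i|].
  rewrite mkseqS /s pursue_rcons.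
  by case/andP: (cop_moves_answer (n - size (mkseq r k)).-1
    (pursue n c (mkseq r k)) (r k)); case: ifP.
have [//|free] := boolp.EM (exists k i, s (mkseq r k) i = r k \/
  s (mkseq r k.+1) i = r k).
have off k : ~~ on_robber (pursue n c (mkseq r k)) (r k).
  by apply/negP=> /s_on[i si]; apply: free; exists k, i; left.
have off' k : ~~ on_robber (pursue n c (mkseq r k.+1)) (r k).
  by apply/negP=> /s_on[i si]; apply: free; exists k, i; right.
(* While the robber is free, each round uses up one of the [n] moves; at [k = n] the cops must stand
   on him. *)
have inv k : k <= n -> wins_within (n - k) (pursue n c (mkseq r k)) (r k).
  elim: k => [_|k IH lt_kn]; first by rewrite subn0; apply: win.
  move: (off' k) (IH (ltnW lt_kn)); rewrite mkseqS pursue_rcons size_mkseq subnS.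
  case E: (n - k) => [|m]; first by move/eqP: E; rewrite subn_eq0 leqNgt lt_kn.
  move=> /negbTE off'k /answer_wins; rewrite (negbTE (off k)) off'k /=.
  by move/forallP/(_ (r k.+1))/implyP; apply; apply: r_legal.
by case/negP: (off n); have := inv n (leqnn n); rewrite subnn /= orbF.
Qed.

End Game.

Unset Implicit Arguments.

Theorem theorem3p9 (G : sgraph) (G_connected : connected_graph G)
    (G_P5_free : free_of (path_graph 5) G)
    (G_K4_free : free_of (complete_graph 4) G) :
  cop_number G <= 2.
Proof.
suff win : cops_win G 2.
  rewrite /cop_number; case: ex_minnP => m _ /(_ 2); apply.
  exact/boolp.asboolP.
move=> v.
(* Either some placement beats every robber start, or every placement has a start from which the
   robber evades. *)
have [[c win]|no] :=
    boolp.EM (exists c : G * G, forall r, exists n, wins_within n c r).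
  have [n win_n] := @wins_within_uniform G predT c (fun r _ => win r).
  exact: (@cops_win2 G n c G_connected (fun r => win_n r isT)).
case: (@no_evasion G G_connected G_P5_free G_K4_free
  (fun p q => evades (p, q)) _ _ v) => [p q r|p q r p' q'|p q].
- exact: evades_far.
- by move=> ev pp' qq'; apply: evades_step ev _; apply/andP.
have [//|lose] := boolp.EM (exists r, evades (p, q) r).
case: no; exists (p, q) => r.
have [//|no] := boolp.EM (exists n, wins_within n (p, q) r).
by case: lose; exists r => n; apply/negP=> win; apply: no; exists n.
Qed.
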